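(* Let $\mathcal{L}$ be a finite trim lattice of length $n$, and let $\gamma$ and $\gamma'$ be the left modular labellings associated to two chains $(x_i)_{i=0}^n$ and $(x'_i)_{i=0}^n$ of left modular elements of length $n$. Then $\mathrm{row}^\gamma=\mathrm{row}^{\gamma'}$ as maps $\mathcal{L}\to\mathcal{L}$.
   Context: A finite lattice of length $n$ is extremal if it has exactly $n$ join-irreducible and $n$ meet-irreducible elements; an element $x$ is left modular if $(y\vee x)\wedge z=y\vee(x\wedge z)$ for all $y\le z$; the lattice is trim if it is extremal and has a maximal chain of left modular elements. For a chain $\hat0=x_0\lessdot\dots\lessdot x_n=\hat1$ of left modular elements, the left modular labelling is $\gamma(y\lessdot z)=\min\{i\in[n]: y\vee(x_i\wedge z)=z\}$; $\mathrm{D}^\gamma(y)=\{\gamma(x\lessdot y): x\lessdot y\}$, $\mathrm{U}^\gamma(y)=\{\gamma(y\lessdot z): y\lessdot z\}$. For trim lattices each element $y$ is determined by $\mathrm{U}^\gamma(y)$ and $\{\mathrm{D}^\gamma(x)\}_{x}=\{\mathrm{U}^\gamma(y)\}_{y}$, so rowmotion $\mathrm{row}^\gamma(x)$, the unique $y$ with $\mathrm{U}^\gamma(y)=\mathrm{D}^\gamma(x)$, is well defined; $\mathrm{row}^{\gamma'}$ is defined analogously. *)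

(* Defs.v *)
From mathcomp Require Import all_boot all_order.

Set Implicit Arguments.
Unset Strict Implicit.
Unset Printing Implicit Defensive.

Import Order.Theory.
Local Open Scope order_scope.

Section LatticeNotions.
Context {d : Order.disp_t} (L : finTBLatticeType d).
Implicit Types (x y z j m : L) (C : {set L}).

Definition is_chain C : bool := [forall y in C, forall z in C, y >=< z].

(* A chain with k elements has length k - 1; chains need not be saturated. *)
Definition lattice_length : nat := (\max_(C : {set L} | is_chain C) #|C|).-1.

Definition covers y z : bool := (y < z) && ~~ [exists w, y < w < z].

Definition join_irreducible j : bool :=
  (j != \bot) && [forall y, forall z, (j == y `|` z) ==> (j == y) || (j == z)].

Definition meet_irreducible m : bool :=
  (m != \top) && [forall y, forall z, (m == y `&` z) ==> (m == y) || (m == z)].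

Definition extremal : Prop :=
  #|[set j : L | join_irreducible j]| = lattice_length /\
  #|[set m : L | meet_irreducible m]| = lattice_length.

Definition left_modular x : Prop :=
  forall y z, y <= z -> (y `|` x) `&` z = y `|` (x `&` z).

Definition trim : Prop :=
  extremal /\
  exists2 C : {set L}, maxset is_chain C & {in C, forall x, left_modular x}.

End LatticeNotions.

Section Labelling.
Context {d : Order.disp_t} {L : finTBLatticeType d} {n : nat}.
Implicit Types (x : 'I_n.+1 -> L) (gamma : L -> L -> 'I_n.+1) (y z w : L).

Definition left_modular_chain x : Prop :=
  [/\ x ord0 = \bot,
      x ord_max = \top,
      forall i j : 'I_n.+1, (j = i.+1 :> nat) -> covers (x i) (x j)
    & forall i : 'I_n.+1, left_modular (x i)].

(* Labels live in {0, ..., n}, the index set of the chain, but 0 is excluded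
   from the minimum. When y < z and x n = \top, the index n is admissible
   (n > 0 is forced if also x 0 = \bot), so the minimum is over a nonempty
   set; the value on other pairs is irrelevant. *)
Definition left_modular_labelling x y z : 'I_n.+1 :=
  [arg min_(i < ord_max | (0 < i)%N && (y `|` (x i `&` z) == z)) (i : nat)]%N.

Definition down_labels gamma y : {set 'I_n.+1} :=
  [set gamma w y | w : L & covers w y].

Definition up_labels gamma y : {set 'I_n.+1} :=
  [set gamma y w | w : L & covers y w].

(* The unique z such that up_labels gamma z = down_labels gamma y; the junk
   value y is returned if there is no such z or more than one, which does not
   happen for a left modular labelling of a trim lattice. *)
Definition rowmotion gamma y : L :=
  odflt y [pick z | [forall w,
    (up_labels gamma w == down_labels gamma y) == (w == z)]].

End Labelling.

(* Main.v *)
(** Along a maximal left modular chain, extremality puts exactly one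
    join-irreducible [j i] and one meet-irreducible [m i] on each step
    [x i < x i.+1]: [j i <= x i.+1], [~ j i <= x i], [x i <= m i],
    [~ x i.+1 <= m i].  A cover [y < z] carries the label of step [i] iff
    [j i <= z] and [y <= m i].  Since [j a <= m b] for [a < b] while
    [~ j i <= m i], the relation [~ j a <= m b] is triangular, so it contains
    only one perfect matching; hence the pairs [(j i, m i)] do not depend on the
    chain, two left modular labellings differ by a relabelling, and rowmotion
    only sees equality of labels. *)
Require Import Defs.
From mathcomp Require Import all_boot all_order.

Set Implicit Arguments.
Unset Strict Implicit.
Unset Printing Implicit Defensive.

Import Order.Theory.
Local Open Scope order_scope.

Section Irreducibles.
Context {d : Order.disp_t} (L : finTBLatticeType d).

(** Among the elements below [a] but not below [b], take one with the smallest down-set: everything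
    strictly under it lies below [b], so it is not a join of two strictly smaller elements. *)
Lemma join_irreducible_separates (a b : L) : ~~ (a <= b) ->
  exists j, [/\ join_irreducible j, j <= a & ~~ (j <= b)].
Proof.
move=> nab; pose P c := (c <= a) && ~~ (c <= b).
have Pa : P a by rewrite /P lexx.
case: (arg_minnP (fun c => #|[set w | w <= c]|) Pa) => c /andP[ca cb] cmin.
have below w : w < c -> w <= b.
  move=> wc; apply/negPn/negP => wb.
  have /cmin : P w by rewrite /P wb (le_trans (ltW wc) ca).
  apply/negP; rewrite -ltnNge; apply: proper_card; apply/properP; split.
    by apply/subsetP => v; rewrite !inE => /le_trans; apply; exact: ltW.
  by exists c; rewrite !inE ?lexx // (lt_geF wc).
exists c; split=> //; apply/andP; split.
  by apply: contraNneq cb => ->; exact: le0x.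
apply/forallP => y; apply/forallP => z; apply/implyP => /eqP cyz.
rewrite -[_ || _]negbK negb_or; apply/negP => /andP[cy cz].
case/negP: cb; rewrite cyz leUx !below // lt_neqAle eq_sym ?cy ?cz cyz.
  exact: leUr.
exact: leUl.
Qed.

End Irreducibles.

Lemma meet_irreducible_separates (d : Order.disp_t) (L : finTBLatticeType d)
    (a b : L) : ~~ (a <= b) ->
  exists m, [/\ meet_irreducible m, b <= m & ~~ (a <= m)].
Proof. exact: (@join_irreducible_separates _ L^d b a). Qed.

Lemma covers_between (d : Order.disp_t) (L : finTBLatticeType d) (y z w : L) :
  covers y z -> y <= w -> w <= z -> w != y -> w = z.
Proof.
case/andP=> _ /existsPn/(_ w) nyz yw wz wy; apply/eqP.
move: nyz; rewrite lt_neqAle yw eq_sym wy /= lt_neqAle wz andbT.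
by rewrite negbK.
Qed.

Section Chain.
Context {d : Order.disp_t} {L : finTBLatticeType d} {n : nat}.
Implicit Types (x : 'I_n.+1 -> L) (i k : 'I_n).

Local Notation lo i := (widen_ord (leqnSn n) i).
Local Notation hi i := (lift ord0 i).

Lemma left_modular_chain_homo x (a b : 'I_n.+1) :
  left_modular_chain x -> (a <= b)%N -> x a <= x b.
Proof.
case=> _ _ cov _; case: b => b.
elim: b => [|b IHb] bn /=.
  by rewrite leqn0 => /eqP a0; rewrite (_ : Ordinal bn = a) //; apply/val_inj.
rewrite leq_eqVlt => /predU1P[ab|ab].
  by rewrite (_ : Ordinal bn = a) //; apply/val_inj.
have bn' : (b < n.+1)%N by apply: ltnW.
apply: le_trans (IHb bn' ab) _.
by have /andP[/ltW] := cov (Ordinal bn') (Ordinal bn) erefl.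
Qed.

(** ['I_n] indexes the steps of the chain, from [x (lo i)] to [x (hi i)]. The image equations say
    that no irreducible is missed; injectivity follows from the step conditions. *)
Definition irreducible_labelling x (j m : 'I_n -> L) : Prop :=
  [/\ forall i, (j i <= x (hi i)) && ~~ (j i <= x (lo i)),
      forall i, (x (lo i) <= m i) && ~~ (x (hi i) <= m i),
      j @: setT = [set a | join_irreducible a]
    & m @: setT = [set a | meet_irreducible a] ].

Lemma join_step_inj x a i k : left_modular_chain x ->
  (a <= x (hi i)) && ~~ (a <= x (lo i)) ->
  (a <= x (hi k)) && ~~ (a <= x (lo k)) -> i = k.
Proof.
move=> cx /andP[ai nai] /andP[ak nak]; apply/val_inj.
case: (ltngtP i k) => // ik.
  by case/negP: nak; apply: le_trans ai _; apply: left_modular_chain_homo.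
by case/negP: nai; apply: le_trans ak _; apply: left_modular_chain_homo.
Qed.

Lemma meet_step_inj x a i k : left_modular_chain x ->
  (x (lo i) <= a) && ~~ (x (hi i) <= a) ->
  (x (lo k) <= a) && ~~ (x (hi k) <= a) -> i = k.
Proof.
move=> cx /andP[ai nai] /andP[ak nak]; apply/val_inj.
case: (ltngtP i k) => // ik.
  by case/negP: nai; apply: le_trans _ ak; apply: left_modular_chain_homo.
by case/negP: nak; apply: le_trans _ ai; apply: left_modular_chain_homo.
Qed.

(** Separating the two ends of each step gives [n] distinct irreducibles of each kind, and
    extremality leaves no others. *)
Lemma irreducible_labelling_exists x :
  lattice_length L = n -> extremal L -> left_modular_chain x ->
  exists j m, irreducible_labelling x j m.
Proof.
move=> len [cardJ cardM] cx; have [_ _ cov _] := cx.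
have nle i : ~~ (x (hi i) <= x (lo i)).
  by have /andP[/lt_geF->] := cov (lo i) (hi i) erefl.
have [j jP] := fin_all_exists (fun i => join_irreducible_separates (nle i)).
have [m mP] := fin_all_exists (fun i => meet_irreducible_separates (nle i)).
have jstep i : (j i <= x (hi i)) && ~~ (j i <= x (lo i)).
  by have [_ -> ->] := jP i.
have mstep i : (x (lo i) <= m i) && ~~ (x (hi i) <= m i).
  by have [_ -> ->] := mP i.
exists j, m; split=> //; apply/eqP; rewrite eqEcard; apply/andP; split.
- by apply/subsetP => _ /imsetP[i _ ->]; rewrite inE; have [] := jP i.
- rewrite cardJ len card_imset ?cardsT ?card_ord // => i k jik.
  by apply: (join_step_inj cx (jstep i)); rewrite jik; exact: jstep.
- by apply/subsetP => _ /imsetP[i _ ->]; rewrite inE; have [] := mP i.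
- rewrite cardM len card_imset ?cardsT ?card_ord // => i k mik.
  by apply: (meet_step_inj cx (mstep i)); rewrite mik; exact: mstep.
Qed.

Section Labelled.
Variables (x : 'I_n.+1 -> L) (j m : 'I_n -> L).
Hypotheses (cx : left_modular_chain x) (jm : irreducible_labelling x j m).

(** As the step is a cover, [x (lo i)] and [j i] join to [x (hi i)], which is not below [m i]. *)
Lemma labelled_pair_nle i : ~~ (j i <= m i).
Proof.
have [/(_ i)/andP[ji nji] /(_ i)/andP[mi nmi] _ _] := jm.
have [_ _ /(_ (lo i) (hi i) erefl) cov _] := cx.
apply: contra nmi => jmi.
rewrite -(covers_between (w := x (lo i) `|` j i) cov) ?leUl //.
- by rewrite leUx mi.
- by rewrite leUx ji andbT; case/andP: cov => /ltW.
- by rewrite eq_joinl.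
Qed.

Lemma labelled_pair_triangular i k : ~~ (j i <= m k) -> (k <= i)%N.
Proof.
have [/(_ i)/andP[ji _] /(_ k)/andP[mk _] _ _] := jm.
rewrite leqNgt; apply: contra => ik.
by apply: le_trans ji (le_trans _ mk); apply: left_modular_chain_homo.
Qed.

(** Index [hi i] is admissible because [j i] lies below [x (hi i)] and [z] but not below [y]. A
    smaller admissible index would force [z <= m i], hence [j i <= m i]. *)
Lemma left_modular_labelling_unique y z i : covers y z ->
  j i <= z -> y <= m i -> left_modular_labelling x y z = hi i.
Proof.
move=> yz jz ym; have [_ xn _ _] := cx.
have [/(_ i)/andP[ji _] /(_ i)/andP[mi _] _ _] := jm.
have yltz : y <= z by case/andP: yz => /ltW.
have adm : (0 < hi i)%N && (y `|` (x (hi i) `&` z) == z).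
  apply/eqP; apply: (covers_between yz); rewrite ?leUl //.
    by rewrite leUx yltz leIr.
  rewrite eq_joinl; apply: contra (labelled_pair_nle i) => xz.
  by apply: le_trans ym; apply: le_trans xz; rewrite lexI ji.
rewrite /left_modular_labelling; case: arg_minnP => [|k].
  by rewrite xn meet1x (join_idPr yltz) eqxx (leq_trans _ (ltn_ord i)).
move=> /andP[k0 /eqP kz] /(_ _ adm) ki; apply/val_inj/eqP.
rewrite eqn_leq ki /= ltnNge; apply: contra (labelled_pair_nle i) => ki'.
apply: le_trans jz _; rewrite -kz leUx ym /=.
by apply: le_trans (leIl _ _) (le_trans _ mi); apply: left_modular_chain_homo.
Qed.

Lemma left_modular_labelling_exists y z : covers y z ->
  exists i, [/\ left_modular_labelling x y z = hi i, j i <= z & y <= m i].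
Proof.
move=> yz; have [x0 xn _ xmod] := cx; have [jS mS jJ mM] := jm.
have yltz : y < z by case/andP: yz.
(* Positivity of [n] makes the default index [ord_max] of the minimum admissible. *)
have n0 : (0 < n)%N.
  rewrite lt0n; apply: contraTneq yltz => n0.
  have bt : \bot = \top :> L.
    by rewrite -x0 -xn; congr (x _); apply/val_inj.
  by rewrite le_gtF // (le_trans (lex1 z)) // -bt le0x.
rewrite /left_modular_labelling; case: arg_minnP => [|b].
  by rewrite xn meet1x (join_idPr (ltW yltz)) n0 eqxx.
case: (unliftP ord0 b) => [i ->|->] //= /eqP iz imin.
exists i.
(* Minimality of the label gives this, except at [i = 0]: index 0 is excluded from the minimum, but
   there [x] is [\bot]. *)
have loz : x (lo i) `&` z <= y.
  have [i0|i0] := posnP i.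
    by rewrite (_ : lo i = ord0) ?x0 ?meet0x ?le0x //; apply/val_inj.
  rewrite -eq_joinl; apply/negPn/negP => ny.
  have /imin : (0 < lo i)%N && (y `|` (x (lo i) `&` z) == z).
    rewrite i0; apply/eqP/(covers_between yz); rewrite ?leUl //.
    by rewrite leUx leIr ltW.
  by rewrite ltnn.
split=> //.
(* A join-irreducible below [x (hi i)] and [z] but not below [y] must enter the chain at step [i],
   by [loz]; so it is [j i]. *)
- have /join_irreducible_separates[a [aJ]] : ~~ (x (hi i) `&` z <= y).
    by rewrite -eq_joinl iz gt_eqF.
  rewrite lexI => /andP[ax az] nay.
  have /imsetP[k _ ak] : a \in j @: setT by rewrite jJ inE.
  suff <- : k = i by rewrite -ak.
  apply: (join_step_inj cx (jS k)); rewrite -ak ax /=.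
  by apply: contra nay => axl; apply: le_trans loz; rewrite lexI axl.
(* Left modularity of [x (lo i)] turns [loz] into this non-inequality: otherwise [z] would equal
   [y]. *)
- have /meet_irreducible_separates[a [aM]] : ~~ (z <= y `|` x (lo i)).
    apply: contraTN (yltz) => zy; rewrite le_gtF //.
    have /meet_idPr := zy; rewrite (xmod (lo i) y z (ltW yltz)) => <-.
    by rewrite leUx lexx.
  rewrite leUx => /andP[ya xa] nza.
  have /imsetP[k _ ak] : a \in m @: setT by rewrite mM inE.
  suff <- : k = i by rewrite -ak.
  apply: (meet_step_inj cx (mS k)); rewrite -ak xa /=.
  apply: contra nza => hia.
  by rewrite -iz leUx ya (le_trans (leIl _ _)).
Qed.

End Labelled.

Lemma labelled_pair_canonical x x' j m j' m' i :
  left_modular_chain x -> left_modular_chain x' ->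
  irreducible_labelling x j m -> irreducible_labelling x' j' m' ->
  exists k, j' k = j i /\ m' k = m i.
Proof.
move=> cx cx' jm jm'; have [_ _ jJ mM] := jm; have [jS' mS' jJ' mM'] := jm'.
have jsub k : exists a, j k = j' a.
  have /imsetP[a _ ->] : j k \in j' @: setT by rewrite jJ' -jJ imset_f.
  by exists a.
have msub k : exists a, m k = m' a.
  have /imsetP[a _ ->] : m k \in m' @: setT by rewrite mM' -mM imset_f.
  by exists a.
(* [s] and [t] send a step of [x] to the steps of [x'] that carry the same join- and
   meet-irreducible; the goal becomes [s = t]. *)
have [s sP] := fin_all_exists jsub; have [t tP] := fin_all_exists msub.
have [jS mS _ _] := jm.
have s_inj : injective s.
  move=> a b sab; apply: (join_step_inj cx (jS a)).
  by rewrite sP sab -sP jS.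
have t_inj : injective t.
  move=> a b tab; apply: (meet_step_inj cx (mS a)).
  by rewrite tP tab -tP mS.
have ts k : (t k <= s k)%N.
  apply: (labelled_pair_triangular cx' jm').
  by rewrite -sP -tP (labelled_pair_nle cx jm).
have sum_perm (u : 'I_n -> 'I_n) :
    injective u -> (\sum_k (u k : nat) = \sum_(k < n) (k : nat))%N.
  by move=> u_inj; rewrite [RHS](reindex_inj u_inj).
(* Both maps permute ['I_n], so their values have equal sums, and the pointwise inequality [ts] must
   be an equality everywhere. *)
have st k : t k = s k.
  apply/val_inj/eqP.
  have /leqif_sum[_] : forall k, true -> (t k <= s k ?= iff (t k == s k :> nat))%N.
    by move=> a _; split.
  by rewrite !sum_perm // eqxx => /esym/forallP/(_ k).
by exists (s i); rewrite -sP -st -tP.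
Qed.

(** Covers with the same label share a pair [(j i, m i)]; this is also a pair of the other chain,
    and determines the label there. *)
Lemma left_modular_labelling_transfer x x' y z v w :
  lattice_length L = n -> extremal L ->
  left_modular_chain x -> left_modular_chain x' -> covers y z -> covers v w ->
  left_modular_labelling x y z = left_modular_labelling x v w ->
  left_modular_labelling x' y z = left_modular_labelling x' v w.
Proof.
move=> len extr cx cx' yz vw.
have [j [m jm]] := irreducible_labelling_exists len extr cx.
have [j' [m' jm']] := irreducible_labelling_exists len extr cx'.
have [i [-> jz ym]] := left_modular_labelling_exists cx jm yz.
have [k [-> jw vm]] := left_modular_labelling_exists cx jm vw.
move=> /lift_inj ik; rewrite -ik in jw vm.
have [a [ja ma]] := labelled_pair_canonical i cx cx' jm jm'.
by rewrite !(left_modular_labelling_unique cx' jm' (i := a)) ?ja ?ma.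
Qed.

Lemma up_down_labels_transfer (g g' : L -> L -> 'I_n.+1) y w :
  (forall a b c e, covers a b -> covers c e -> g a b = g c e ->
     g' a b = g' c e) ->
  up_labels g w = down_labels g y -> up_labels g' w = down_labels g' y.
Proof.
move=> gg' /setP ud; apply/setP => c; apply/imsetP/imsetP => -[u].
- rewrite inE => wu ->; have := ud (g w u).
  rewrite imset_f ?inE // => /esym/imsetP[v]; rewrite inE => vy guv.
  by exists v; rewrite ?inE //; apply: gg'.
- rewrite inE => uy ->; have := ud (g u y).
  rewrite [RHS]imset_f ?inE // => /imsetP[v]; rewrite inE => wv guv.
  by exists v; rewrite ?inE //; apply: gg'.
Qed.

End Chain.

Theorem theorem4p4 (d : Order.disp_t) (L : finTBLatticeType d) (n : nat)
    (x x' : 'I_n.+1 -> L) (length_L : lattice_length L = n) (trim_L : trim L)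
    (chain_x : left_modular_chain x) (chain_x' : left_modular_chain x') :
  rowmotion (left_modular_labelling x) =1 rowmotion (left_modular_labelling x').
Proof.
(* Both sides have the same default [y], so it suffices that the two equations between label sets
   are equivalent for each [w]. *)
move=> y; rewrite /rowmotion; congr odflt; apply: eq_pick => z.
have [extr _] := trim_L.
apply: eq_forallb => w; congr (_ == _).
by apply/eqP/eqP; apply: up_down_labels_transfer => a b c e ab ce;
  apply: left_modular_labelling_transfer.
Qed.
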